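(* Let $L\ge1$, let $$D=\Bigl\{(p,q_1,\ldots,q_L):\ p+\sum_{j=1}^Lq_j=1,\ \sum_{j=1}^Ljq_j>p,\ q_j\ge0\text{ for all }j,\ p>0\Bigr\},$$ and for $P=(p,q_1,\ldots,q_L)\in D$ let $M$ be the associated $L\times L$ matrix. (1) If $P\in D$, then $\lambda_M=\rho(M)>1$. (2) Consider the $(L,1)$-reflecting random walk on $\mathbb{Z}^+$ with parameters $P(i):=(p(i),q_1(i),\ldots,q_L(i))$, $i\ge1$. If $P(i)\to P$ as $i\to\infty$ and $P\in D$, then the stationary distribution $\pi$ of the walk exists, and $$\lim_{i\to\infty}\frac{\log\pi(i)}{i}=-\log\lambda_M .$$
   Context: The $(L,1)$-reflecting random walk is the Markov chain $\{X_n\}_{n\ge0}$ on $\mathbb{Z}^+=\{0,1,2,\ldots\}$ with $X_0=0$ and the following transition probabilities. For each $i\ge1$ we are given $q_1(i),\ldots,q_L(i)\ge0$ and $0<p(i)<1$ with $q_1(i)+\cdots+q_L(i)+p(i)=1$. Then $P_{01}=p(0)=1$; for $0<i<L$: $P_{i,i+1}=p(i)$, $P_{ij}=q_{i-j}(i)$ for $0<j<i$, and $P_{i0}=\sum_{k=i}^Lq_k(i)$; for $i\ge L$: $P_{i,i+1}=p(i)$ and $P_{ij}=q_{i-j}(i)$ for $i-L\le j<i$; all other transition probabilities are $0$. The chain is irreducible. For $P=(p,q_1,\ldots,q_L)$, the $L\times L$ matrix $M=(m_{lj})$ is defined by: the first row is $(q_1/p,\,q_2/p,\,\ldots,\,q_L/p)$,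 and for $2\le l\le L$ the $l$-th row equals the first row plus $1$ in column $l-1$; i.e. $m_{lj}=q_j/p+\mathbf 1_{\{j=l-1\}}$. $\rho(M)$ denotes the spectral radius of $M$ and $\lambda_M$ its maximum eigenvalue (the largest real eigenvalue). *)

(* Defs.v *)
From HB Require Import structures.
From mathcomp Require Import all_boot all_order all_algebra.
From mathcomp Require Import complex.
From mathcomp Require Import all_classical all_reals all_analysis.
Import Order.TTheory GRing.Theory Num.Theory.
Import numFieldNormedType.Exports.

Set Implicit Arguments.
Unset Strict Implicit.
Unset Printing Implicit Defensive.

Local Open Scope classical_set_scope.
Local Open Scope ring_scope.

(* A parameter vector P = (p, q_1, ..., q_L) is a pair P : R * 'rV[R]_L;
   coordinates are 0-based, so q_(k+1) is P.2 0 k. *)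

Definition drift_domain (R : realType) (L : nat) : set (R * 'rV[R]_L) :=
  [set P : R * 'rV[R]_L | [/\ P.1 + \sum_(j < L) P.2 0 j = 1,
               P.1 < \sum_(j < L) j.+1%:R * P.2 0 j,
               (forall j : 'I_L, 0 <= P.2 0 j)
             & 0 < P.1]].

Definition step_mx (R : realType) (L : nat) (P : R * 'rV[R]_L) : 'M[R]_L :=
  \matrix_(l < L, j < L) (P.2 0 j / P.1 + (l == j.+1 :> nat)%:R).

(* The sets below are finite, so each sup is a maximum as soon as the set is
   nonempty; sup set0 = 0. *)
Definition max_eigenvalue (R : realType) (n : nat) (A : 'M[R]_n) : R :=
  sup [set a : R | eigenvalue A a].

Definition spectral_radius (R : realType) (n : nat) (A : 'M[R]_n) : R :=
  sup [set ComplexField.Normc.normc z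
      | z in [set z : R[i] | eigenvalue (map_mx (real_complex R) A) z]].

(* State 0 moves to 1 with probability 1, whatever P 0 is. *)
Definition rrw_trans (R : realType) (L : nat) (P : nat -> R * 'rV[R]_L)
    (i j : nat) : R :=
  if i == 0%N then (j == 1%N)%:R
  else if j == i.+1 then (P i).1
  else if (i <= j)%N then 0
  else if (i < L)%N && (j == 0%N) then
    \sum_(k < L | (i <= k.+1)%N) (P i).2 0 k
  else (* q_(i-j)(i), or 0 when i - j > L *)
    \sum_(k < L | k.+1 == (i - j)%N) (P i).2 0 k.

Definition rrw_parameters (R : realType) (L : nat)
    (P : nat -> R * 'rV[R]_L) : Prop :=
  forall i, (0 < i)%N ->
    [/\ 0 < (P i).1 < 1,
        (forall j : 'I_L, 0 <= (P i).2 0 j)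
      & \sum_(j < L) (P i).2 0 j + (P i).1 = 1].

Definition stationary_distribution (R : realType) (T : nat -> nat -> R)
    (mu : nat -> R) : Prop :=
  [/\ forall i, 0 <= mu i,
      series mu @ \oo --> (1 : R)
    & forall j, series (fun i => mu i * T i j) @ \oo --> mu j].

(* Main.v *)
Require Import Defs.
From mathcomp Require Import all_boot all_order all_algebra.
From mathcomp Require Import complex.
From mathcomp Require Import zify lra ring.
From mathcomp Require Import all_classical all_reals all_analysis.
Import Order.TTheory GRing.Theory Num.Theory.
Import numFieldNormedType.Exports.

Local Open Scope classical_set_scope.
Local Open Scope ring_scope.

Set Implicit Arguments.
Unset Strict Implicit.
Unset Printing Implicit Defensive.

(** The walk moves up by one level at a time, so a stationary [mu] is
    characterised by balance across each cut between [N] and [N.+1]: the upward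
    flow [p(N) mu N] equals the downward flow
    [\sum_k mu (N + k.+1) * (probability of a jump down by more than k)]. This
    gives [mu N] from the [L] following values ([backward_recursion]), and part (2)
    is a study of the positive solutions of that recursion.

    The coefficients of the recursion converge. The limit recursion has the
    solution [j |-> x ^+ j] whenever [\sum_k jump_tail P k * x ^+ k.+1 = P.1],
    and the drift condition provides such an [x] in (0, 1) by the intermediate
    value theorem ([characteristic_root]). The same [x] yields an explicit positive
    eigenvector of [step_mx P] for [x^-1]; as the matrix is nonnegative, [x^-1] is
    then both its largest real eigenvalue and its spectral radius
    ([perron_eigenvalue]), which proves part (1).

    For part (2), a left eigenvector of the companion matrix of the limit
    recursion defines a functional [phi j] of [u j, ..., u (j + L - 1)] that is
    comparable to [u j] and satisfies [phi j.+1 / phi j --> x] for every positive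
    solution [u]; by Cesaro's lemma [ln (u j) / j --> ln x]
    ([backward_recursion_rate]). In particular every positive solution is summable,
    so a stationary distribution exists as soon as a positive solution does, and
    one is obtained by compactness from truncated recursions
    ([backward_recursion_exists]). For uniqueness, the difference [w] of two
    stationary distributions satisfies the balance equations together with [`|w|],
    so that [`|w| + w] is either zero or positive everywhere
    ([stationary_distribution_le]). *)

(** * A nonnegative matrix with a positive eigenvector *)

(** A left eigenvector [w] for [z], paired in absolute value with the positive right eigenvector
    [v], gives [|z| (|w| v) <= |w| A v = lam (|w| v)] with [|w| v > 0]. *)


Lemma normc_eigenvalue_le (R : realType) (n : nat) (A : 'M[R]_n) (v : 'cV[R]_n)
    (lam : R) (z : R[i]) :
  (forall i j, 0 <= A i j) -> (forall i, 0 < v i 0) -> A *m v = lam *: v ->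
  eigenvalue (map_mx (real_complex R) A) z ->
  ComplexField.Normc.normc z <= lam.
Proof.
move=> A_ge0 v_gt0 Av /eigenvalueP[w wA w_neq0].
have w_norm j : `|z| * `|w 0 j| <= \sum_k `|w 0 k| * (A k j)%:C%C.
  move/rowP/(_ j): wA; rewrite !mxE => wj.
  rewrite -normrM -wj; apply: le_trans (ler_norm_sum _ _ _) _.
  apply: ler_sum => k _; rewrite normrM mxE ler_wpM2l// ger0_norm//.
  by rewrite lecR.
have [j wj_neq0] : exists j, w 0 j != 0.
  apply: contrapT => /forallNP w0; case/negP: w_neq0; apply/eqP/rowP => j.
  by move: (w0 j); rewrite mxE => /negP; rewrite negbK => /eqP.
have pairing_gt0 : 0 < \sum_j `|w 0 j| * (v j 0)%:C%C.
  rewrite (bigD1 j)//= ltr_wpDr//; last by rewrite mulr_gt0 ?normr_gt0 ?ltcR.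
  by apply: sumr_ge0 => k _; rewrite mulr_ge0// lecR ltW.
suff : `|z| <= lam%:C%C by rewrite normc_def lecR; case: (z).
rewrite -(ler_pM2r pairing_gt0) mulr_sumr.
under eq_bigr => k _ do rewrite mulrA.
apply: le_trans (_ : \sum_j (\sum_k `|w 0 k| * (A k j)%:C%C) * (v j 0)%:C%C <= _).
  by apply: ler_sum => k _; rewrite ler_wpM2r ?w_norm// lecR ltW.
under eq_bigr => k _ do rewrite mulr_suml.
rewrite exchange_big mulr_sumr; apply: ler_sum => k _ /=.
under eq_bigr => l _ do rewrite -mulrA -rmorphM/=.
rewrite -mulr_sumr -rmorph_sum/= mulrCA ler_wpM2l//.
by move/colP/(_ k): Av; rewrite !mxE => ->; rewrite rmorphM.
Qed.

(** [eigenvalue] is defined by left eigenvectors; a matrix and its transpose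
    have the same determinant. *)
Lemma eigenvalue_colP (F : fieldType) (n : nat) (A : 'M[F]_n) (v : 'cV[F]_n)
    (a : F) :
  A *m v = a *: v -> v != 0 -> eigenvalue A a.
Proof.
move=> Av v_neq0; have : \det (A - a%:M)^T == 0.
  apply/det0P; exists v^T; first by rewrite trmx_eq0.
  by rewrite -trmx_mul mulmxBl Av mul_scalar_mx subrr trmx0.
rewrite det_tr => /det0P[w w_neq0 /eqP].
rewrite mulmxBr subr_eq0 mul_mx_scalar => /eqP wA.
by apply/eigenvalueP; exists w.
Qed.

Lemma sup_maximum (R : realType) (E : set R) (a : R) :
  E a -> ubound E a -> sup E = a.
Proof.
move=> Ea ubEa; apply/le_anti/andP; split; first by apply: ge_sup => //; exists a.
by apply: ub_le_sup => //; exists a.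
Qed.

(** The elementary half of the Perron-Frobenius theorem. *)
Lemma perron_eigenvalue (R : realType) (n : nat) (A : 'M[R]_n) (v : 'cV[R]_n)
    (lam : R) :
  (0 < n)%N -> (forall i j, 0 <= A i j) -> (forall i, 0 < v i 0) ->
  A *m v = lam *: v ->
  max_eigenvalue A = lam /\ spectral_radius A = lam.
Proof.
move=> n_gt0 A_ge0 v_gt0 Av.
have v_neq0 : v != 0.
  apply/eqP => /colP/(_ (Ordinal n_gt0)); rewrite mxE => v0.
  by move: (v_gt0 (Ordinal n_gt0)); rewrite v0 ltxx.
have eig_lam := eigenvalue_colP Av v_neq0.
have lam_ge0 : 0 <= lam.
  have : 0 <= (A *m v) (Ordinal n_gt0) 0.
    by rewrite mxE sumr_ge0// => k _; rewrite mulr_ge0// ltW.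
  by rewrite Av mxE pmulr_lge0.
split; apply: sup_maximum => //.
- move=> a eig_a; have := normc_eigenvalue_le A_ge0 v_gt0 Av.
  move/(_ a%:C%C); rewrite eigenvalue_map => /(_ eig_a) /=.
  by rewrite expr0n addr0 sqrtr_sqr; apply: le_trans; exact: ler_norm.
- exists lam%:C%C => /=; first by rewrite eigenvalue_map.
  by rewrite expr0n addr0 sqrtr_sqr ger0_norm.
- by move=> _ [z eig_z <-]; exact: normc_eigenvalue_le eig_z.
Qed.

(** * The characteristic root of the step matrix *)

(** The probability of jumping down by more than [m] levels. *)
Definition jump_tail (R : realType) (L : nat) (P : R * 'rV[R]_L) (m : nat) : R :=
  \sum_(k < L | (m <= k)%N) P.2 0 k.

Lemma sum_jump_tail (R : realType) (L : nat) (P : R * 'rV[R]_L) (f : nat -> R) :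
  \sum_(k < L) jump_tail P k * f k =
  \sum_(l < L) P.2 0 l * \sum_(k < l.+1) f k.
Proof.
under eq_bigr => k _ do rewrite mulr_suml.
rewrite (exchange_big_dep xpredT)//=; apply: eq_bigr => l _.
by rewrite -mulr_sumr (big_ord_widen_cond L xpredT)//; exact: ltn_ord.
Qed.

(** The generating function [\sum_k jump_tail P k * x ^+ k.+1] is [0] at [0] and
    the mean downward jump at [1]; positive drift towards [0] makes the latter
    exceed [P.1]. *)
Lemma characteristic_root (R : realType) (L : nat) (P : R * 'rV[R]_L) :
  drift_domain P ->
  exists2 x : R, 0 < x < 1 & \sum_(k < L) jump_tail P k * x ^+ k.+1 = P.1.
Proof.
move=> [_ drift _ p_gt0].
pose g : {poly R} := \sum_(k < L) jump_tail P k *: 'X^(k.+1) - P.1%:P.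
have gE x : g.[x] = \sum_(k < L) jump_tail P k * x ^+ k.+1 - P.1.
  rewrite /g hornerD hornerN hornerC horner_sum; congr (_ - _).
  by apply: eq_bigr => k _; rewrite hornerZ hornerXn.
have g0 : g.[0] < 0.
  rewrite gE big1 ?sub0r ?oppr_lt0// => k _.
  by rewrite expr0n mulr0.
have g1 : 0 < g.[1].
  rewrite gE subr_gt0; apply: lt_le_trans drift _.
  under [leRHS]eq_bigr => k _ do rewrite expr1n.
  rewrite (sum_jump_tail P (fun=> 1)); apply: ler_sum => l _.
  by rewrite sumr_const card_ord mulrC.
have [|x /andP[x_ge0 x_le1] /rootP gx] := @poly_ivt R g 0 1 ler01.
  by rewrite !ltW.
exists x; last by apply/eqP; rewrite -subr_eq0 -gE gx.
rewrite !lt_neqAle x_ge0 x_le1 !andbT; apply/andP; split.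
  by apply: contraTneq g0 => x0; rewrite -x0 in gx; rewrite gx ltxx.
by apply: contraTneq g1 => x1; rewrite x1 in gx; rewrite gx ltxx.
Qed.

(** With [v_l = x + ... + x ^+ l.+1], every row of [step_mx P] contributes
    [\sum_j q_j / p * v_j = 1] by the choice of [x], plus [v_(l-1)]; and
    [1 + v_(l-1) = x^-1 * v_l]. *)
Lemma step_mx_eigenvalues (R : realType) (L : nat) (P : R * 'rV[R]_L) (x : R) :
  (0 < L)%N -> (forall j, 0 <= P.2 0 j) -> 0 < P.1 -> 0 < x ->
  \sum_(k < L) jump_tail P k * x ^+ k.+1 = P.1 ->
  max_eigenvalue (step_mx P) = x^-1 /\ spectral_radius (step_mx P) = x^-1.
Proof.
move=> L_gt0 q_ge0 p_gt0 x_gt0 xP.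
pose v l := \sum_(k < l) x ^+ k.+1.
apply: (@perron_eigenvalue _ _ _ (\col_(l < L) v l.+1)) => //.
- by move=> i j; rewrite mxE addr_ge0// divr_ge0// ltW.
- move=> i; rewrite mxE /v big_ord_recl ltr_wpDr ?exprn_gt0//.
  by apply: sumr_ge0 => k _; rewrite exprn_ge0// ltW.
apply/colP => l; rewrite !mxE.
under eq_bigr => j _ do rewrite !mxE mulrDl mulrAC.
rewrite big_split/= -mulr_suml -(sum_jump_tail P (fun k => x ^+ k.+1)) xP.
rewrite divff ?gt_eqF//.
have -> : \sum_(j < L) (l == j.+1 :> nat)%:R * v j.+1 = v l.
  case: l => -[|l] lL /=.
    by rewrite big1 ?/v ?big_ord0// => j _; rewrite mul0r.
  rewrite (bigD1 (Ordinal (ltnW lL)))//= eqxx mul1r big1 ?addr0// => j.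
  rewrite -val_eqE/= => /negPf jl; rewrite eqSS eq_sym jl mul0r//.
rewrite /v [in RHS]big_ord_recl mulrDr expr1 mulVf ?gt_eqF//; congr (_ + _).
rewrite mulr_sumr; apply: eq_bigr => k _.
by rewrite lift0 [in RHS]exprS mulKf ?gt_eqF.
Qed.

(** * Positive solutions of a backward recursion *)

Lemma cvg_sumr (R : realType) (T I : Type) (F : set_system T) (FF : Filter F)
    (r : seq I) (Q : pred I) (f : I -> T -> R) (l : I -> R) :
  (forall i, Q i -> f i n @[n --> F] --> l i) ->
  \sum_(i <- r | Q i) f i n @[n --> F] --> \sum_(i <- r | Q i) l i.
Proof. by move=> fl; apply: cvg_big => //; exact: add_continuous. Qed.

Definition backward_recursion (R : realType) (L : nat) (c : nat -> nat -> R)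
    (u : nat -> R) : Prop :=
  forall j, u j = \sum_(k < L) c j k * u (j + k.+1)%N.

Lemma recursion_term_le (R : realType) (L : nat) (a u : nat -> R) :
  (0 < L)%N -> (forall k, 0 <= a k) -> (forall k, 0 <= u k) ->
  a 0%N * u 0%N <= \sum_(k < L) a k * u k.
Proof.
move=> L_gt0 a_ge0 u_ge0; rewrite (bigD1 (Ordinal L_gt0))//= lerDl.
by apply: sumr_ge0 => k _; rewrite mulr_ge0.
Qed.

Lemma backward_recursion_ge (R : realType) (L : nat) (c : nat -> nat -> R)
    (u : nat -> R) (j : nat) :
  (0 < L)%N -> (forall i k, 0 <= c i k) -> (forall i, 0 <= u i) ->
  backward_recursion L c u -> c j 0%N * u j.+1 <= u j.
Proof.
move=> L_gt0 c_ge0 u_ge0 uE; rewrite [leRHS]uE.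
under eq_bigr => k _ do rewrite addnS -addSn.
have := @recursion_term_le _ L (c j) (fun k => u (j.+1 + k)%N) L_gt0.
by rewrite addn0; apply.
Qed.

(** A zero propagates upwards because [c j 0 * u j.+1 <= u j], and downwards
    because each term is a combination of later ones. *)
Lemma backward_recursion_gt0 (R : realType) (L : nat) (c : nat -> nat -> R)
    (u : nat -> R) (i0 : nat) :
  (0 < L)%N -> (forall i k, 0 <= c i k) -> (forall i, 0 < c i 0%N) ->
  (forall i, 0 <= u i) -> backward_recursion L c u -> u i0 != 0 ->
  forall i, 0 < u i.
Proof.
move=> L_gt0 c_ge0 c0_gt0 u_ge0 uE ui0 i; rewrite lt_neqAle u_ge0 andbT eq_sym.
apply: contra_neq ui0 => ui.
have up d : u (i + d)%N = 0.
  elim: d => [|d IHd]; first by rewrite addn0.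
  apply/le_anti; rewrite u_ge0 andbT addnS -(ler_pM2l (c0_gt0 (i + d)%N)).
  by rewrite mulr0 -IHd (@backward_recursion_ge _ L).
have down : forall d m, (i - d <= m)%N -> u m = 0.
  elim=> [|d IHd] m; first by rewrite subn0 => /subnKC <-.
  by rewrite uE => im; rewrite big1// => k _; rewrite IHd ?mulr0//; lia.
by apply: (down i); rewrite subnn.
Qed.

(** Prescribing [u] beyond level [N], and then solving downwards. *)
Lemma truncated_recursion (R : realType) (L : nat) (c : nat -> nat -> R)
    (N : nat) :
  (0 < L)%N -> (forall i k, 0 <= c i k) -> (forall i, 0 < c i 0%N) ->
  exists u : nat -> R,
    [/\ forall i, 0 <= u i, u 0%N = 1, forall i, (N < i)%N -> u i = 0
      & forall j, (j < N)%N -> u j = \sum_(k < L) c j k * u (j + k.+1)%N].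
Proof.
move=> L_gt0; elim: N c => [|N IHN] c c_ge0 c0_gt0.
  by exists (fun j => (j == 0%N)%:R); split=> // i i_gt0; rewrite gtn_eqF.
have [v [v_ge0 v0 v_end vE]] :=
  IHN (fun i => c i.+1) (fun i => c_ge0 i.+1) (fun i => c0_gt0 i.+1).
pose s := \sum_(k < L) c 0%N k * v k.
have s_gt0 : 0 < s.
  apply: lt_le_trans (recursion_term_le L_gt0 (c_ge0 0%N) v_ge0).
  by rewrite v0 mulr1.
exists (fun j => (if j is i.+1 then v i else s) / s); split.
- by case=> [|i]; rewrite divr_ge0// ltW.
- by rewrite divff ?gt_eqF.
- by case=> // i /v_end ->; rewrite mul0r.
- case=> [_|j /vE vj]; under eq_bigr do rewrite mulrA.
    by rewrite -mulr_suml.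
  by rewrite -mulr_suml vj.
Qed.

Lemma continuous_recursion (R : realType) (L j : nat) (a : nat -> R) :
  let T := prod_topology (fun _ : nat => R : topologicalType) in
  continuous (fun f : T => f j - \sum_(k < L) a k * f (j + k.+1)%N).
Proof.
move=> T f.
have proj_cont i : continuous (fun f : T => f i).
  exact: (@proj_continuous _ (fun _ => R) i).
have nbhs_f : Filter (nbhs f) by exact: nbhs_filter.
have term_cvg (k : 'I_L) :
    a k * g (j + k.+1)%N @[g --> nbhs f] --> a k * f (j + k.+1)%N.
  by apply: (@cvgMl_tmp R T (nbhs f) nbhs_f); exact: proj_cont.
have sum_cvg := @cvg_sumr R T 'I_L (nbhs f) nbhs_f (index_enum 'I_L) xpredT _ _
                  (fun k _ => term_cvg k).
exact: (cvgB (proj_cont j f) sum_cvg).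
Qed.

(** The normalised truncated solutions satisfy [u j.+1 <= u j / c j 0] and hence
    stay in a product of segments, which is compact; a cluster point solves the
    recursion at every level because each single equation is a closed condition
    that eventually holds. *)
Lemma backward_recursion_exists (R : realType) (L : nat)
    (c : nat -> nat -> R) :
  (0 < L)%N -> (forall i k, 0 <= c i k) -> (forall i, 0 < c i 0%N) ->
  exists u : nat -> R, backward_recursion L c u /\ forall i, 0 < u i.
Proof.
move=> L_gt0 c_ge0 c0_gt0.
have [U Uprop] := choice (fun N => truncated_recursion N L_gt0 c_ge0 c0_gt0).
pose B j := \prod_(i < j) (c i 0%N)^-1.
have B_ge0 j : 0 <= B j by apply: prodr_ge0 => i _; rewrite invr_ge0.
pose T := prod_topology (fun _ : nat => R : topologicalType).
pose V N : T := U N.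
have K_compact : compact [set f : T | forall j, f j \in `[0, B j]].
  exact: (@tychonoff _ (fun _ => R) (fun j => [set` `[0, B j]])
            (fun j => @segment_compact _ _ _)).
have VK N j : V N j \in `[0, B j].
  have [u_ge0 u0 u_end uE] := Uprop N.
  rewrite in_itv/= u_ge0/=; elim: j => [|j IHj].
    by rewrite /V u0 /B big_ord0.
  have [jN|Nj] := ltnP j N; last by rewrite /V u_end.
  rewrite /B big_ord_recr/= -/(B j) ler_pdivlMr//.
  apply: le_trans IHj; rewrite /V [leRHS]uE// mulrC.
  under eq_bigr => k _ do rewrite addnS -addSn.
  have := @recursion_term_le _ L (c j) (fun k => U N (j.+1 + k)%N) L_gt0.
  by rewrite addn0; apply.
have [|f [fK]] := K_compact (V @ \oo) _.
  by exists 0%N => // N _ j; exact: VK.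
rewrite clusterE => f_cluster.
have closed_eq (g : T -> R) : continuous g -> closed [set h | g h = 0].
  move=> g_cont; apply: (@preimage_closed _ _ g [set 0]).
    by move=> h _; exact: g_cont.
  exact: closed_eq.
have limit_eq (g : T -> R) :
    continuous g -> (\forall N \near \oo, g (V N) = 0) -> g f = 0.
  move=> g_cont gV; have := closed_eq g g_cont; apply.
  exact: (f_cluster [set h | g h = 0]).
exists f; have fE : backward_recursion L c f.
  move=> j; apply/eqP; rewrite -subr_eq0; apply/eqP.
  apply: (limit_eq (fun h => h j - \sum_(k < L) c j k * h (j + k.+1)%N)).
    exact: continuous_recursion.
  exists j.+1 => //= N jN; have [_ _ _ uE] := Uprop N.
  by apply/eqP; rewrite subr_eq0; apply/eqP; exact: uE.
split=> //; apply: (@backward_recursion_gt0 _ L c f 0%N) => //.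
  by move=> j; have /andP[] := fK j.
have : f 0%N - 1 = 0.
  apply: (limit_eq (fun h => h 0%N - 1)).
    move=> h; have nbhs_h : Filter (nbhs h) by exact: nbhs_filter.
    have := cvgB (@proj_continuous _ (fun _ => R) 0%N h)
              (@cvg_cst _ (1 : R) _ (nbhs h) nbhs_h).
    exact.
  by apply: nearW => N; have [_ u0 _ _] := Uprop N; rewrite /V u0 subrr.
by move/eqP; rewrite subr_eq0 => /eqP ->; exact: oner_neq0.
Qed.

(** * Exponential rate of a positive solution *)

Lemma cvg_increments (R : realType) (f : nat -> R) (l : R) :
  f n.+1 - f n @[n --> \oo] --> l -> f n / n%:R @[n --> \oo] --> l.
Proof.
move=> /cesaro incr; rewrite -cvg_shiftS/=.
have -> : (fun n => f n.+1 / n.+1%:R) =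
    (fun n => arithmetic_mean (telescope f) n + f 0%N * harmonic n).
  apply/funext => n; rewrite /arithmetic_mean/= telescopeK/=.
  by rewrite [f 0%N * _]mulrC -mulrDr subrK mulrC.
rewrite -[l]addr0 -[X in l + X](mulr0 (f 0%N)).
by apply: cvgD => //; apply: cvgMl_tmp; exact: cvg_harmonic.
Qed.

Lemma cvg_ln_comparable (R : realType) (u f : nat -> R) (C l : R) :
  0 < C -> (forall n, 0 < u n) ->
  (\forall n \near \oo, u n <= f n <= C * u n) ->
  ln (f n) / n%:R @[n --> \oo] --> l -> ln (u n) / n%:R @[n --> \oo] --> l.
Proof.
move=> C_gt0 u_gt0 uf fl.
have lower : (ln (f n) - ln C) / n%:R @[n --> \oo] --> l.
  have -> : (fun n => (ln (f n) - ln C) / n%:R) =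
            (fun n => ln (f n) / n%:R - ln C * n%:R^-1).
    by apply/funext => n; rewrite mulrBl.
  rewrite -[l]subr0 -[X in l - X](mulr0 (ln C)); apply: cvgB => //.
  apply: cvgMl_tmp; rewrite -cvg_shiftS; exact: cvg_harmonic.
apply: squeeze_cvgr lower fl.
near=> n; have /andP[ufn fun_] : u n <= f n <= C * u n by near: n.
have fn_gt0 : 0 < f n := lt_le_trans (u_gt0 n) ufn.
apply/andP; split; rewrite ler_wpM2r ?invr_ge0//; last by rewrite ler_ln ?posrE.
by rewrite lerBlDr addrC -lnM ?posrE// ler_ln ?posrE ?mulr_gt0.
Unshelve. all: by end_near. Qed.

Lemma is_cvg_series_of_ln (R : realType) (u : nat -> R) (l : R) :
  (forall n, 0 < u n) -> l < 0 -> ln (u n) / n%:R @[n --> \oo] --> l ->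
  cvgn (series u).
Proof.
move=> u_gt0 l_lt0 ul.
(* Any rate strictly between l and 0 would do. *)
set y := expR (l / 2).
have [N _ uN] : \forall n \near \oo, u n <= y ^+ n.
  near=> n; have n_gt0 : 0 < n%:R :> R by rewrite ltr0n; near: n; exists 1%N.
  rewrite -[u n]lnK ?posrE// -expRM_natr ler_expR -ler_pdivrMr//.
  by near: n; apply: (cvgr_le _ ul); rewrite ltr_pdivlMr// mulr_natr; lra.
pose v n := if (n < N)%N then 0 else u n.
rewrite -(is_cvg_series_restrict N).
have -> : (fun n => \sum_(N <= k < n) u k) = (fun n => \sum_(N <= k < n) v k).
  apply/funext => n; apply: eq_big_nat => k /andP[Nk _].
  by rewrite /v ltnNge Nk.
rewrite is_cvg_series_restrict.
apply: (@series_le_cvg _ _ (geometric 1 y)) => [n|n|n|].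
- by rewrite /v; case: ifP => // _; exact: ltW.
- by rewrite /= mul1r exprn_ge0// expR_ge0.
- rewrite /v /= mul1r; case: ltnP => [_|/uN//].
  by rewrite exprn_ge0// expR_ge0.
- by apply: is_cvg_geometric_series; rewrite gtr0_norm ?expR_gt0// expR_lt1; lra.
Unshelve. all: by end_near. Qed.

(** When [\sum_k a k * x ^+ k.+1 = 1], these weights form a left eigenvector,
    for the eigenvalue [x^-1], of the companion matrix of the recursion
    [u j = \sum_k a k * u (j + k.+1)]; it is normalised by its first entry
    being 1. *)
Definition companion_weight (R : realType) (L : nat) (a : nat -> R) (x : R)
    (m : nat) : R :=
  \sum_(l < L | (m <= l)%N) a l * x ^+ (l - m).+1.

Lemma companion_weightS (R : realType) (L : nat) (a : nat -> R) (x : R)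
    (m : nat) :
  (m < L)%N ->
  companion_weight L a x m = x * (a m + companion_weight L a x m.+1).
Proof.
move=> mL; rewrite /companion_weight (bigD1 (Ordinal mL))//= subnn expr1.
rewrite mulrDr mulrC; congr (_ + _); rewrite mulr_sumr.
apply: eq_big => [l|l /andP[ml lm]].
  by rewrite -val_eqE/= ltn_neqAle eq_sym andbC.
rewrite mulrCA -exprS; congr (_ * x ^+ _).
by move: lm; rewrite -val_eqE/=; lia.
Qed.

Lemma companion_weight_ge0 (R : realType) (L : nat) (a : nat -> R) (x : R)
    (m : nat) :
  (forall k, 0 <= a k) -> 0 <= x -> 0 <= companion_weight L a x m.
Proof.
by move=> a_ge0 x_ge0; apply: sumr_ge0 => l _; rewrite mulr_ge0 ?exprn_ge0.
Qed.

(** In the functional [phi j = \sum_k w k * u (j + k)] the limit recursion acts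
    as multiplication by [x^-1], and what remains is controlled by the
    deviation of the coefficients from their limits. *)
Lemma companion_functional_step (R : realType) (L : nat) (c : nat -> nat -> R)
    (a u : nat -> R) (x : R) (j : nat) :
  let phi i := \sum_(k < L) companion_weight L a x k * u (i + k)%N in
  \sum_(k < L) a k * x ^+ k.+1 = 1 -> backward_recursion L c u ->
  x * phi j - phi j.+1 = x * \sum_(k < L) (c j k - a k) * u (j.+1 + k)%N.
Proof.
move=> phi xa uE; set w := companion_weight L a x.
have w0 : w 0%N = 1.
  rewrite -xa /w /companion_weight.
  by apply: eq_bigr => l _; rewrite subn0.
have wL : w L = 0.
  by rewrite /w /companion_weight big_pred0// => l; rewrite leqNgt ltn_ord.
have -> : phi j = \sum_(k < L) (c j k + w k.+1) * u (j.+1 + k)%N.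
  have : \sum_(k < L.+1) w k * u (j + k)%N = phi j.
    by rewrite big_ord_recr/= wL mul0r addr0.
  rewrite big_ord_recl/= w0 mul1r addn0 uE -big_split/= => <-.
  by apply: eq_bigr => k _; rewrite mulrDl addSnnS.
rewrite !mulr_sumr -sumrB; apply: eq_bigr => k _.
rewrite -/w [w k]companion_weightS// -/w; ring.
Qed.

(** Since [c j 0] stays away from [0], consecutive values of [u] are comparable,
    so [u] and the functional [phi] have the same exponential rate; and
    [phi j.+1 / phi j] tends to [x] because the deviations from the limit
    recursion are negligible with respect to [phi]. *)
Lemma backward_recursion_rate (R : realType) (L : nat) (c : nat -> nat -> R)
    (a u : nat -> R) (x : R) :
  (0 < L)%N -> (forall j k, 0 <= c j k) -> (forall k, 0 <= a k) -> 0 < a 0%N ->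
  (forall k, c j k @[j --> \oo] --> a k) ->
  0 < x -> \sum_(k < L) a k * x ^+ k.+1 = 1 ->
  backward_recursion L c u -> (forall j, 0 < u j) ->
  ln (u j) / j%:R @[j --> \oo] --> ln x.
Proof.
move=> L_gt0 c_ge0 a_ge0 a0_gt0 ca x_gt0 xa uE u_gt0.
pose w := companion_weight L a x.
pose phi i := \sum_(k < L) w k * u (i + k)%N.
have w_ge0 k : 0 <= w k by apply: companion_weight_ge0 => //; exact: ltW.
have u_ge0 j : 0 <= u j by exact: ltW.
have u_le_phi j : u j <= phi j.
  have := @recursion_term_le _ L w (fun k => u (j + k)%N) L_gt0 w_ge0.
  have -> : w 0%N = 1.
    by rewrite -xa /w /companion_weight; apply: eq_bigr => l _; rewrite subn0.
  by rewrite mul1r addn0; apply.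
have phi_gt0 j : 0 < phi j := lt_le_trans (u_gt0 j) (u_le_phi j).
pose K := 2 / a 0%N; have K_gt0 : 0 < K by rewrite divr_gt0.
have [J _ uK] : \forall j \near \oo, u j.+1 <= K * u j.
  near=> j; rewrite -ler_pdivrMl// invf_div.
  apply: le_trans (backward_recursion_ge j L_gt0 c_ge0 u_ge0 uE).
  rewrite ler_wpM2r//; near: j; apply: (cvgr_ge _ (ca 0%N)).
  by rewrite ltr_pdivrMr//; lra.
have uKX j k : (J <= j)%N -> u (j + k)%N <= K ^+ k * u j.
  move=> Jj; elim: k => [|k IHk]; first by rewrite addn0 mul1r.
  rewrite addnS exprS -mulrA; apply: le_trans (uK _ _) _.
    by rewrite /= (leq_trans Jj) ?leq_addr.
  by rewrite ler_pM2l.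
apply: (@cvg_ln_comparable _ _ phi (1 + \sum_(k < L) w k * K ^+ k)) => //.
- rewrite ltr_wpDr//; apply: sumr_ge0 => k _.
  by rewrite mulr_ge0 ?w_ge0// exprn_ge0// ltW.
- exists J => //= j Jj; rewrite u_le_phi/= mulrDl mul1r mulr_suml.
  apply: (@le_trans _ _ (\sum_(k < L) w k * K ^+ k * u j)); last by rewrite lerDr.
  by apply: ler_sum => k _; rewrite -mulrA ler_wpM2l ?uKX ?w_ge0.
apply: cvg_increments.
have ratio : x * phi j / phi j.+1 @[j --> \oo] --> (1 : R).
  suff : `|x * phi j / phi j.+1 - 1| @[j --> \oo] --> (0 : R).
    by move=> dist0; apply/subr_cvg0; exact: norm_cvg0 dist0.
  pose err j := x * \sum_(k < L) `|c j k - a k| * K ^+ k.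
  have err0 : err j @[j --> \oo] --> (0 : R).
    have dev0 k : `|c j k - a k| * K ^+ k @[j --> \oo] --> 0 * K ^+ k.
      apply: cvgMr_tmp; rewrite -(normr0 R); apply: cvg_norm.
      by apply/subr_cvg0; exact: ca.
    have sum0 := @cvg_sumr R nat 'I_L \oo eventually_filter (index_enum 'I_L) xpredT _ _
                   (fun k _ => dev0 k).
    rewrite -[X in _ --> X](mulr0 x); apply: cvgMl_tmp.
    have lim0 : \sum_(k < L) 0 * K ^+ k = 0 by rewrite big1// => k _; rewrite mul0r.
    by rewrite lim0 in sum0.
  have zero0 : (0 : R) @[j --> \oo] --> (0 : R) by exact: cvg_cst.
  apply: squeeze_cvgr zero0 err0.
  exists J => //= j Jj; rewrite normr_ge0/=.
  have -> : x * phi j / phi j.+1 - 1 = (x * phi j - phi j.+1) / phi j.+1.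
    by rewrite mulrBl divff ?gt_eqF.
  rewrite normrM normfV [`|phi _|]gtr0_norm// ler_pdivrMr//.
  rewrite (companion_functional_step _ xa uE) normrM gtr0_norm// /err -mulrA.
  rewrite ler_pM2l//; apply: le_trans (ler_norm_sum _ _ _) _.
  rewrite mulr_suml; apply: ler_sum => k _; rewrite normrM -mulrA ler_wpM2l//.
  rewrite ger0_norm//; apply: le_trans (uKX _ _ _) _; first exact: leq_trans Jj _.
  by rewrite ler_wpM2l// exprn_ge0// ltW.
have -> : (fun j => ln (phi j.+1) - ln (phi j)) =
          (fun j => ln x - ln (x * phi j / phi j.+1)).
  apply/funext => j; rewrite ln_div ?posrE ?mulr_gt0// lnM ?posrE//; ring.
rewrite -[ln x in X in _ --> X]subr0 -(ln1 R); apply: cvgB; first exact: cvg_cst.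
by apply: (continuous_cvg _ _ ratio); exact: continuous_ln.
Unshelve. all: by end_near. Qed.

(** * Stationarity as balance across cuts *)

Definition up_prob (R : realType) (L : nat) (Pw : nat -> R * 'rV[R]_L)
    (i : nat) : R :=
  if i == 0%N then 1 else (Pw i).1.

(** The balance equation of the cut between [j] and [j.+1], solved for its
    value at [j], has these coefficients. *)
Definition balance_coef (R : realType) (L : nat) (Pw : nat -> R * 'rV[R]_L)
    (j k : nat) : R :=
  jump_tail (Pw (j + k.+1)%N) k / up_prob Pw j.

(** The sum stops at [j + L] because no higher state reaches [j] in one step. *)
Definition inflow (R : realType) (L : nat) (Pw : nat -> R * 'rV[R]_L)
    (mu : nat -> R) (j : nat) : R :=
  \sum_(i < (j + L).+1) mu i * rrw_trans Pw i j.

Lemma jump_tail_ge0 (R : realType) (L : nat) (P : R * 'rV[R]_L) (m : nat) :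
  (forall j, 0 <= P.2 0 j) -> 0 <= jump_tail P m.
Proof. by move=> q_ge0; apply: sumr_ge0. Qed.

Lemma jump_tail_le (R : realType) (L : nat) (P : R * 'rV[R]_L) (m : nat) :
  (forall j, 0 <= P.2 0 j) -> jump_tail P m <= \sum_(k < L) P.2 0 k.
Proof.
move=> q_ge0; rewrite /jump_tail big_mkcond/=.
by apply: ler_sum => k _; case: ifP.
Qed.

Lemma up_prob_gt0 (R : realType) (L : nat) (Pw : nat -> R * 'rV[R]_L) (i : nat) :
  rrw_parameters Pw -> 0 < up_prob Pw i.
Proof.
move=> params; rewrite /up_prob; case: eqP => // /eqP.
by rewrite -lt0n => /params[/andP[]].
Qed.

Lemma rrw_trans_ge0 (R : realType) (L : nat) (Pw : nat -> R * 'rV[R]_L)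
    (i j : nat) :
  rrw_parameters Pw -> 0 <= rrw_trans Pw i j.
Proof.
move=> params; rewrite /rrw_trans; case: posnP => [_|/params[/andP[p_gt0 _] q_ge0 _]].
  exact: ler0n.
case: ifP => _; first exact: ltW.
by case: ifP => // _; case: ifP => _; apply: sumr_ge0.
Qed.

Lemma rrw_trans_support (R : realType) (L : nat) (Pw : nat -> R * 'rV[R]_L)
    (i j : nat) :
  (j + L < i)%N -> rrw_trans Pw i j = 0.
Proof.
move=> jLi; rewrite /rrw_trans gtn_eqF; last by lia.
rewrite ltn_eqF; last by lia.
rewrite leqNgt (_ : (j < i)%N)/=; last by lia.
rewrite ltnNge (_ : (L <= i)%N)/=; last by lia.
by rewrite big_pred0// => k; apply/negbTE; have := ltn_ord k; lia.
Qed.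

Lemma sum_rrw_trans (R : realType) (L : nat) (Pw : nat -> R * 'rV[R]_L)
    (i N : nat) :
  rrw_parameters Pw ->
  \sum_(j < N.+1) rrw_trans Pw i j =
  if (i < N)%N then 1
  else if i == N then 1 - up_prob Pw N else jump_tail (Pw i) (i - N.+1).
Proof.
move=> params; elim: N => [|N IHN].
  rewrite big_ord_recl big_ord0 addr0/= /rrw_trans.
  have [_|i_gt0] := posnP i; first by rewrite /up_prob subrr.
  rewrite ltn_eqF// leqNgt i_gt0/= andbT subn0 /jump_tail.
  case: ltnP => [iL|Li]; apply: eq_bigl => k; first by lia.
  by have := ltn_ord k; lia.
rewrite big_ord_recr IHN/= /rrw_trans.
have [iN|Ni|iN] := ltngtP i N.
- rewrite (_ : (i < N.+1)%N); last by lia.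
  case: posnP => [_|_]; first by rewrite (_ : (_ == _) = false) ?addr0//; lia.
  rewrite gtn_eqF ?ltnS// (_ : (i <= N.+1)%N) ?addr0//; lia.
- rewrite (_ : (i == 0%N) = false); last by lia.
  rewrite (_ : (N.+1 == i.+1) = false); last by lia.
  rewrite (_ : (i < N.+1)%N = false); last by lia.
  rewrite andbF; have [->|NSi] := eqVneq i N.+1.
    rewrite leqnn addr0 subnn /up_prob/=.
    have [_ _ <-] := params N.+1 isT; rewrite addrK.
    by apply: eq_bigl.
  rewrite (_ : (i <= N.+1)%N = false); last by lia.
  rewrite /jump_tail addrC [RHS](bigID (fun k : 'I_L => k.+1 == (i - N.+1)%N))/=.
  by congr (_ + _); apply: eq_bigl => k; lia.
- rewrite iN ltnSn eqxx /up_prob; case: ifP => [/eqP ->|_]; last by rewrite subrK.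
  by rewrite subrr add0r.
Qed.

Lemma inflow_series (R : realType) (L : nat) (Pw : nat -> R * 'rV[R]_L)
    (mu : nat -> R) (j n : nat) :
  (j + L < n)%N ->
  \sum_(i < n) mu i * rrw_trans Pw i j = inflow Pw mu j.
Proof.
move=> jLn; rewrite /inflow [RHS](big_ord_widen n (fun i => mu i * rrw_trans Pw i j))//.
rewrite [RHS]big_mkcond; apply: eq_bigr => i _; case: ifPn => //.
by rewrite ltnS -ltnNge => jLi; rewrite rrw_trans_support ?mulr0.
Qed.

(** Summing the stationarity defects over the states [0, ..., N] leaves the net
    flow through the cut between [N] and [N.+1]: upwards only the step from
    [N], downwards the jumps from [N + k.+1] by more than [k]. Stationarity of
    [mu] is not assumed, because the identity also serves for [`|w|] below. *)
Lemma cut_balance (R : realType) (L : nat) (Pw : nat -> R * 'rV[R]_L)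
    (mu : nat -> R) (N : nat) :
  rrw_parameters Pw ->
  \sum_(j < N.+1) (inflow Pw mu j - mu j) =
  \sum_(k < L) mu (N + k.+1)%N * jump_tail (Pw (N + k.+1)%N) k
    - up_prob Pw N * mu N.
Proof.
move=> params; rewrite sumrB.
have -> : \sum_(j < N.+1) inflow Pw mu j =
    \sum_(i < N.+1 + L) mu i * \sum_(j < N.+1) rrw_trans Pw i j.
  transitivity (\sum_(j < N.+1) \sum_(i < N.+1 + L) mu i * rrw_trans Pw i j).
    apply: eq_bigr => j _; rewrite inflow_series//.
    by rewrite ltn_add2r ltn_ord.
  by rewrite exchange_big; apply: eq_bigr => i _; rewrite mulr_sumr.
under eq_bigr => i _ do rewrite sum_rrw_trans//.
rewrite big_split_ord/= !big_ord_recr/= ltnn eqxx.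
under eq_bigr => i _ do rewrite ltn_ord mulr1.
under [X in _ + X - _]eq_bigr => k _.
  rewrite (_ : (N.+1 + k < N)%N = false); last by lia.
  rewrite (_ : (N.+1 + k == N)%N = false); last by lia.
  rewrite addKn addSnnS; over.
by ring.
Qed.

(** The defects vanish one by one exactly when all their partial sums do. *)
Lemma inflow_recursionP (R : realType) (L : nat) (Pw : nat -> R * 'rV[R]_L)
    (mu : nat -> R) :
  rrw_parameters Pw ->
  (forall j, inflow Pw mu j = mu j) <->
  backward_recursion L (balance_coef Pw) mu.
Proof.
move=> params.
have cutE N : \sum_(j < N.+1) (inflow Pw mu j - mu j) =
    up_prob Pw N * (\sum_(k < L) balance_coef Pw N k * mu (N + k.+1)%N - mu N).
  rewrite cut_balance// mulrBr mulr_sumr; congr (_ - _).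
  apply: eq_bigr => k _; rewrite /balance_coef mulrA mulrCA mulfV ?mulr1 1?mulrC//.
  by rewrite gt_eqF ?up_prob_gt0.
split=> [inflowE j|muE j].
  have := cutE j; rewrite big1 => [|i _]; last by rewrite inflowE subrr.
  move/esym/eqP; rewrite mulf_eq0 gt_eqF ?up_prob_gt0//= subr_eq0.
  by move/eqP => ->.
have cut0 N : \sum_(i < N.+1) (inflow Pw mu i - mu i) = 0.
  by rewrite cutE -muE subrr mulr0.
apply/eqP; rewrite -subr_eq0 -(cut0 j) big_ord_recr/=.
by case: j => [|j]; rewrite ?cut0 ?big_ord0 add0r.
Qed.

Lemma stationary_distributionP (R : realType) (L : nat)
    (Pw : nat -> R * 'rV[R]_L) (mu : nat -> R) :
  rrw_parameters Pw ->
  stationary_distribution (rrw_trans Pw) mu <->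
  [/\ forall i, 0 <= mu i, series mu @ \oo --> (1 : R)
    & backward_recursion L (balance_coef Pw) mu].
Proof.
move=> params.
have flow_cvg j :
    series (fun i => mu i * rrw_trans Pw i j) @ \oo --> inflow Pw mu j.
  apply: cvg_near_cst; exists (j + L).+1 => //= n jLn.
  by rewrite seriesEnat/= big_mkord inflow_series.
split=> -[mu_ge0 mu1 muE]; split=> //.
  apply/(inflow_recursionP mu params) => j.
  exact: (cvg_unique _ (flow_cvg j) (muE j)).
by move=> j; have <- := (inflow_recursionP mu params).2 muE j; exact: flow_cvg.
Qed.

(** * Uniqueness of the stationary distribution *)

(** The triangle inequality makes [`|w|] subinvariant, so its net flow through
    successive cuts is nonnegative and nondecreasing; as [w] vanishes at infinity
    that flow is zero. *)
Lemma normr_recursion (R : realType) (L : nat) (Pw : nat -> R * 'rV[R]_L)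
    (w : nat -> R) :
  rrw_parameters Pw -> backward_recursion L (balance_coef Pw) w ->
  w @ \oo --> (0 : R) ->
  backward_recursion L (balance_coef Pw) (fun i => `|w i|).
Proof.
move=> params wE w0; apply/(inflow_recursionP _ params).
pose defect j := inflow Pw (fun i => `|w i|) j - `|w j|.
have defect_ge0 j : 0 <= defect j.
  rewrite subr_ge0 -[in leLHS](inflow_recursionP w params).2//.
  apply: le_trans (ler_norm_sum _ _ _) _; apply: ler_sum => i _.
  by rewrite normrM [`|rrw_trans _ _ _|]ger0_norm ?rrw_trans_ge0.
have sum_defect_le N : \sum_(j < N.+1) defect j <= \sum_(k < L) `|w (N + k.+1)%N|.
  rewrite cut_balance// lerBlDr ler_wpDr//.
    by rewrite mulr_ge0// ltW// up_prob_gt0.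
  apply: ler_sum => k _; rewrite ler_piMr//.
  have [/andP[p_gt0 _] q_ge0 qp1] := params (N + k.+1)%N (ltn_addl _ (ltn0Sn k)).
  by apply: le_trans (jump_tail_le _ q_ge0) _; rewrite -qp1 lerDl ltW.
have tail0 : \sum_(k < L) `|w (N + k.+1)%N| @[N --> \oo] --> (0 : R).
  have term0 k : `|w (N + k.+1)%N| @[N --> \oo] --> (0 : R).
    rewrite -(normr0 R); apply: cvg_norm.
    by rewrite (cvg_shiftn k.+1 w).
  have := @cvg_sumr R nat 'I_L \oo eventually_filter (index_enum 'I_L) xpredT _ _
            (fun k _ => term0 k).
  by rewrite big1.
have sum_defect0 N : \sum_(j < N.+1) defect j <= 0.
  apply: (cvgr_to_ge tail0); exists N => //= n Nn.
  apply: le_trans (sum_defect_le n); rewrite -(subnKC Nn).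
  elim: (n - N)%N => [|d IHd]; first by rewrite addn0.
  by apply: le_trans IHd _; rewrite addnS [leRHS]big_ord_recr/= lerDl.
move=> j; apply/eqP; rewrite -subr_eq0 eq_le defect_ge0 andbT.
apply: le_trans (sum_defect0 j); rewrite big_ord_recr/= lerDr.
by apply: sumr_ge0.
Qed.

Lemma jump_tail0_gt0 (R : realType) (L : nat) (Pw : nat -> R * 'rV[R]_L)
    (i : nat) :
  rrw_parameters Pw -> (0 < i)%N -> 0 < jump_tail (Pw i) 0.
Proof.
move=> params /params[/andP[_ p_lt1] _ qp1].
have -> : jump_tail (Pw i) 0 = 1 - (Pw i).1 by rewrite -qp1 addrK.
by rewrite subr_gt0.
Qed.

Lemma balance_coef_ge0 (R : realType) (L : nat) (Pw : nat -> R * 'rV[R]_L)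
    (j k : nat) :
  rrw_parameters Pw -> 0 <= balance_coef Pw j k.
Proof.
move=> params; have [_ q_ge0 _] := params (j + k.+1)%N (ltn_addl _ (ltn0Sn k)).
by rewrite divr_ge0 ?jump_tail_ge0// ltW// up_prob_gt0.
Qed.

Lemma balance_coef0_gt0 (R : realType) (L : nat) (Pw : nat -> R * 'rV[R]_L)
    (j : nat) :
  rrw_parameters Pw -> 0 < balance_coef Pw j 0.
Proof.
move=> params; by rewrite divr_gt0 ?up_prob_gt0 ?jump_tail0_gt0// addn1.
Qed.

(** If [w = u - v] is positive somewhere, then the nonnegative solution
    [`|w| + w] of the balance equations is positive everywhere, hence so is [w],
    which contradicts that both [u] and [v] have total mass [1]. *)
Lemma stationary_distribution_le (R : realType) (L : nat)
    (Pw : nat -> R * 'rV[R]_L) (u v : nat -> R) :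
  (0 < L)%N -> rrw_parameters Pw ->
  stationary_distribution (rrw_trans Pw) u ->
  stationary_distribution (rrw_trans Pw) v -> forall i, u i <= v i.
Proof.
move=> L_gt0 params /(stationary_distributionP u params)[u_ge0 u1 uE].
move=> /(stationary_distributionP v params)[v_ge0 v1 vE] i0.
rewrite leNgt; apply/negP => uv_i0.
pose w i := u i - v i.
have wE : backward_recursion L (balance_coef Pw) w.
  move=> j; rewrite /w uE vE -sumrB.
  by apply: eq_bigr => k _; rewrite mulrBr.
have w0 : w @ \oo --> (0 : R).
  rewrite -[0]subr0; apply: cvgB; apply: cvg_series_cvg_0.
    by apply/cvg_ex; exists 1.
  by apply/cvg_ex; exists 1.
pose z i := `|w i| + w i.
have zE : backward_recursion L (balance_coef Pw) z.
  move=> j; rewrite /z (normr_recursion params wE w0 j) [w j]wE -big_split/=.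
  by apply: eq_bigr => k _; rewrite -mulrDr.
have z_ge0 i : 0 <= z i by rewrite /z -lerBlDr sub0r -normrN ler_norm.
have w_gt0 i : 0 < w i.
  have : 0 < z i.
    apply: (backward_recursion_gt0 (i0 := i0) L_gt0 _ _ z_ge0 zE).
    - by move=> j k; exact: balance_coef_ge0.
    - by move=> j; exact: balance_coef0_gt0.
    by rewrite gt_eqF// /z ltr_wpDl// subr_gt0.
  by case: (ltrP 0 (w i)) => // w_le0; rewrite /z ler0_norm// addNr ltxx.
have series_w : series w @ \oo --> (0 : R).
  rewrite -(subrr 1); have -> : series w = series u - series v.
    by apply/funext => n; rewrite seriesEnat/= sumrB.
  exact: cvgB.
have : w 0%N <= 0.
  apply: (cvgr_to_ge series_w); exists 1%N => //= -[|n]// _.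
  rewrite seriesEnat/= big_nat_recl// lerDl.
  by apply: sumr_ge0 => k _; exact: ltW.
by rewrite leNgt w_gt0.
Qed.

(** * The limit theorem *)

(** The mean downward jump is positive and at most [L * jump_tail P 0]. *)
Lemma jump_tail0_drift_gt0 (R : realType) (L : nat) (P : R * 'rV[R]_L) :
  drift_domain P -> 0 < jump_tail P 0.
Proof.
move=> [_ drift q_ge0 p_gt0].
have : 0 < L%:R * jump_tail P 0.
  apply: lt_trans p_gt0 (lt_le_trans drift _).
  rewrite /jump_tail mulr_sumr; apply: ler_sum => j _.
  by rewrite ler_wpM2r// ler_nat.
by apply: contraTT; rewrite -!leNgt => ?; rewrite mulr_ge0_le0.
Qed.

Lemma balance_coef_cvg (R : realType) (L : nat) (Pw : nat -> R * 'rV[R]_L)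
    (P : R * 'rV[R]_L) (k : nat) :
  0 < P.1 -> Pw i @[i --> \oo] --> P ->
  balance_coef Pw j k @[j --> \oo] --> jump_tail P k / P.1.
Proof.
move=> p_gt0 PwP; apply: cvgM.
  have tail_cvg : jump_tail (Pw i) k @[i --> \oo] --> jump_tail P k.
    apply: (@cvg_sumr R nat 'I_L \oo eventually_filter) => l _.
    have q_cvg : (Pw i).2 @[i --> \oo] --> P.2.
      by apply: cvg_comp PwP _; exact: cvg_snd.
    exact: (cvg_comp _ _ q_cvg (@coord_continuous R 1 L 0 l P.2)).
  by rewrite (cvg_shiftn k.+1 (fun i => jump_tail (Pw i) k)).
apply: cvgV; first by rewrite gt_eqF.
rewrite -cvg_shiftS /up_prob/= (cvg_shiftS (fun i => (Pw i).1)).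
by apply: cvg_comp PwP _; exact: cvg_fst.
Qed.

(** A negative exponential rate makes any positive solution summable, and it can
    then be normalised. *)
Lemma stationary_distribution_exists (R : realType) (L : nat)
    (Pw : nat -> R * 'rV[R]_L) (l : R) :
  (0 < L)%N -> rrw_parameters Pw -> l < 0 ->
  (forall u : nat -> R, backward_recursion L (balance_coef Pw) u ->
     (forall i, 0 < u i) -> ln (u i) / i%:R @[i --> \oo] --> l) ->
  exists mu, stationary_distribution (rrw_trans Pw) mu /\
    ln (mu i) / i%:R @[i --> \oo] --> l.
Proof.
move=> L_gt0 params l_lt0 rate.
have [||u [uE u_gt0]] := @backward_recursion_exists R L (balance_coef Pw) L_gt0.
- by move=> j k; exact: balance_coef_ge0.
- by move=> j; exact: balance_coef0_gt0.
have u_cvg := is_cvg_series_of_ln u_gt0 l_lt0 (rate u uE u_gt0).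
pose s := limn (series u).
have s_gt0 : 0 < s.
  apply: lt_le_trans (u_gt0 0%N) _; apply: (cvgr_to_ge u_cvg).
  exists 1%N => //= -[|n]// _; rewrite seriesEnat/= big_nat_recl// lerDl.
  by apply: sumr_ge0 => k _; exact: ltW.
pose mu i := u i / s.
have muE : backward_recursion L (balance_coef Pw) mu.
  by move=> j; rewrite /mu uE mulr_suml; apply: eq_bigr => k _; rewrite mulrA.
have mu_gt0 i : 0 < mu i by rewrite divr_gt0.
exists mu; split; last exact: rate.
apply/(stationary_distributionP mu params); split=> // [i|]; first exact: ltW.
have -> : series mu = (fun n => series u n / s).
  by apply/funext => n; rewrite !seriesEnat/= mulr_suml.
by rewrite -(divff (lt0r_neq0 s_gt0)); apply: cvgMr_tmp.
Qed.

Theorem theorem1p3 (R : realType) (L : nat) (hL : (1 <= L)%N)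
    (P : R * 'rV[R]_L) (hP : drift_domain P) :
  (max_eigenvalue (step_mx P) = spectral_radius (step_mx P) /\
   1 < spectral_radius (step_mx P)) /\
  (forall Pw : nat -> R * 'rV[R]_L,
     rrw_parameters Pw ->
     Pw i @[i --> \oo] --> P ->
     exists mu : nat -> R,
       unique (stationary_distribution (rrw_trans Pw)) mu /\
       ln (mu i) / i%:R @[i --> \oo] --> - ln (max_eigenvalue (step_mx P))).
Proof.
have [x /andP[x_gt0 x_lt1] xP] := characteristic_root hP.
have tail0_gt0 := jump_tail0_drift_gt0 hP.
have [_ _ q_ge0 p_gt0] := hP.
have [maxE radE] := step_mx_eigenvalues hL q_ge0 p_gt0 x_gt0 xP.
rewrite maxE radE; split; first by rewrite invf_gt1.
rewrite lnV ?posrE// opprK => Pw params PwP.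
have [|u uE u_gt0|mu [mu_stat mu_rate]] :=
    @stationary_distribution_exists R L Pw (ln x) hL params.
- by rewrite ln_lt0// x_gt0.
- pose a k := jump_tail P k / P.1.
  apply: (@backward_recursion_rate R L (balance_coef Pw) a) => //.
  + by move=> j k; exact: balance_coef_ge0.
  + by move=> k; rewrite divr_ge0 ?jump_tail_ge0// ltW.
  + by rewrite divr_gt0.
  + by move=> k; exact: balance_coef_cvg.
  + under eq_bigr do rewrite mulrAC.
    by rewrite -mulr_suml xP divff ?gt_eqF.
exists mu; split=> //; split=> // nu nu_stat; apply/funext => i.
by apply/le_anti; rewrite !(@stationary_distribution_le R L Pw).
Qed.
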